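(* Fix an effectively o-minimal structure that is effectively polynomially bounded. Let $X\subset\mathbb{R}^n$ be closed and bounded and let $f,g:X\to\mathbb{R}$ be two definable continuous functions with $f^{-1}(0)\subset g^{-1}(0)$. Then there exist $N=\mathrm{eff}(f,g)$ and $C>0$ such that $|g(x)|^N\le C|f(x)|$ for all $x\in X$.
   Context: **Effectively o-minimal structure.** An o-minimal structure $\mathcal{S}$ (expanding the real field), viewed as a collection of definable subsets of $\mathbb{R}^n$, $n\in\mathbb{N}$, together with a filtration $\{\Omega_s\subset\mathcal{S}\}_{s\in\mathbb{N}}$ and a primitive recursive $\mathcal{E}:\mathbb{N}\to\mathbb{N}$ such that: (1) $\Omega_s\subset\Omega_{s+1}$ and $\bigcup_s\Omega_s=\mathcal{S}$; (2) if $A,B\subset\mathbb{R}^n$ lie in $\Omega_s$ then $A\cup B$, $A\cap B$, $\mathbb{R}^n\setminus A$, $A\times B$, $\pi^n_k(A)$ lie in $\Omega_{s+1}$, where $\pi^n_k$ is the projection to the first $k$ coordinates; (3) if $A\subset\mathbb{R}$ lies in $\Omega_s$ then $A$ has at most $\mathcal{E}(s)$ connected components. The format of a definable set $A$ is $\min\{s:A\in\Omega_s\}$; the format of a definable function is that of its graph. **Effectivity.** $\mathrm{eff}(\cdots)$ denotes an explicit primitive recursive function of the formats of its arguments, depending only on the given structure; $N=\mathrm{eff}(f,g)$ means $N\in\mathbb{N}$ is bounded by such a function. The structure is effectively polynomially bounded if for every definable $h:\mathbb{R}\to\mathbb{R}$ there is $N=\mathrm{eff}(h)$ with $h(t)<t^N$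 for all sufficiently large $t$.
   Formalization: N=eff(f,g) is shown with a primitive recursive bound that may depend on n; one bound for all n is shown if coordinate permutations raise formats at most primitive recursively. From the listed axioms alone a bound uniform in n can fail. *)

(* Defs.v *)
From HB Require Import structures.
From mathcomp Require Import all_boot all_order all_algebra all_fingroup.
From mathcomp Require Import all_classical all_reals all_analysis.

Set Implicit Arguments.
Unset Strict Implicit.
Unset Printing Implicit Defensive.

Import Order.TTheory GRing.Theory Num.Theory.
Import numFieldNormedType.Exports.

Local Open Scope classical_set_scope.
Local Open Scope ring_scope.

Inductive primitive_recursive : forall k, (k.-tuple nat -> nat) -> Prop :=
| pr_zero : @primitive_recursive 0 (fun=> 0%N)
| pr_succ : @primitive_recursive 1 (fun x => (tnth x ord0).+1)
| pr_proj k (i : 'I_k) : @primitive_recursive k (fun x => tnth x i)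
| pr_comp k m (f : m.-tuple nat -> nat) (g : 'I_m -> k.-tuple nat -> nat) :
    primitive_recursive f -> (forall i, primitive_recursive (g i)) ->
    @primitive_recursive k (fun x => f [tuple g i x | i < m])
| pr_rec k (f : k.-tuple nat -> nat) (g : k.+2.-tuple nat -> nat) :
    primitive_recursive f -> primitive_recursive g ->
    @primitive_recursive k.+1 (fun x =>
      nat_rec (fun=> nat) (f [tuple of behead x])
        (fun i r => g [tuple of i :: r :: behead x]) (thead x)).

Definition primitive_recursive1 (e : nat -> nat) :=
  primitive_recursive (fun x : 1.-tuple nat => e (tnth x ord0)).

Definition primitive_recursive2 (e : nat -> nat -> nat) :=
  primitive_recursive
    (fun x : 2.-tuple nat => e (tnth x ord0) (tnth x ord_max)).

(* [S n A] says that the subset A of R^n belongs to the collection S. *)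
Definition set_collection (R : realType) := forall n, set (set 'rV[R]_n).

Definition cartesian (R : realType) n m (A : set 'rV[R]_n) (B : set 'rV[R]_m) :
    set 'rV[R]_(n + m) :=
  [set z | A (lsubmx z) /\ B (rsubmx z)].

(* The projection R^(k + m) -> R^k to the first k coordinates. *)
Definition projection (R : realType) k m (A : set 'rV[R]_(k + m)) :
    set 'rV[R]_k :=
  [set lsubmx z | z in A].

(* The graph of the restriction of f to X; values of f off X play no role. *)
Definition graph (R : realType) n (X : set 'rV[R]_n) (f : 'rV[R]_n -> R) :
    set 'rV[R]_(n + 1) :=
  [set row_mx x (f x)%:M | x in X].

Definition graph1 (R : realType) (h : R -> R) : set 'rV[R]_(1 + 1) :=
  graph setT (fun x : 'rV[R]_1 => h (x 0 0)).

(* Singletons are not required to be definable, so both definability with and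
   definability without real parameters are covered. *)
Record o_minimal_expansion (R : realType) (S : set_collection R) : Prop := {
  omin_setT : forall n, S n setT ;
  omin_setU : forall n A B, S n A -> S n B -> S n (A `|` B) ;
  omin_setC : forall n A, S n A -> S n (~` A) ;
  omin_cartesian : forall n m A B,
    S n A -> S m B -> S (n + m)%N (cartesian A B) ;
  omin_projection : forall k m A, S (k + m)%N A -> S k (projection A) ;
  omin_diagonal : forall n (i j : 'I_n), S n [set x | x 0 i = x 0 j] ;
  omin_lt : S 2 [set x | x 0 0 < x 0 1] ;
  omin_add : S (2 + 1)%N (graph setT (fun x : 'rV[R]_2 => x 0 0 + x 0 1)) ;
  omin_mul : S (2 + 1)%N (graph setT (fun x : 'rV[R]_2 => x 0 0 * x 0 1)) ;
  (* singletons being closed intervals, points need no separate mention *)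
  omin_line : forall A, S 1 A -> exists I : seq (interval R),
    [set t : R | A t%:M] = \bigcup_(i in [set` I]) [set` i] }.

Record effectively_o_minimal (R : realType) (S : set_collection R)
    (Omega : nat -> set_collection R) (E : nat -> nat) : Prop := {
  eff_o_minimal : o_minimal_expansion S ;
  eff_primitive_recursive : primitive_recursive1 E ;
  eff_increasing : forall s n, Omega s n `<=` Omega s.+1 n ;
  eff_exhaustive : forall n, \bigcup_s Omega s n = S n ;
  eff_setU : forall s n A B,
    Omega s n A -> Omega s n B -> Omega s.+1 n (A `|` B) ;
  eff_setI : forall s n A B,
    Omega s n A -> Omega s n B -> Omega s.+1 n (A `&` B) ;
  eff_setC : forall s n A, Omega s n A -> Omega s.+1 n (~` A) ;
  eff_cartesian : forall s n A B,
    Omega s n A -> Omega s n B -> Omega s.+1 (n + n)%N (cartesian A B) ;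
  eff_projection : forall s k m A,
    Omega s (k + m)%N A -> Omega s.+1 k (projection A) ;
  eff_components : forall s A, Omega s 1 A ->
    ([set connected_component A x | x in A] #<= `I_(E s))%card }.

(* The default value 0 is only taken on sets that lie in no Omega s. *)
Definition format (R : realType) (Omega : nat -> set_collection R)
    n (A : set 'rV[R]_n) : nat :=
  xget 0%N [set s | Omega s n A /\ forall t, Omega t n A -> (s <= t)%N].

Definition effectively_polynomially_bounded (R : realType)
    (S : set_collection R) (Omega : nat -> set_collection R) : Prop :=
  exists2 e, primitive_recursive1 e &
    forall h : R -> R, S (1 + 1)%N (graph1 h) ->
      exists2 N : nat, (N <= e (format Omega (graph1 h)))%N &
        \forall t \near +oo, h t < t ^+ N.

(* The closure conditions on Omega never reorder coordinates: for fixed n,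
   permuting the coordinates of R^n raises formats by at most a constant, but
   this constant may grow with n in an arbitrary way. *)
Definition effective_permutations (R : realType)
    (Omega : nat -> set_collection R) : Prop :=
  exists2 p, primitive_recursive1 p &
    forall s n (sigma : 'S_n) (A : set 'rV[R]_n),
      Omega s n A -> Omega (p s) n [set col_perm sigma x | x in A].

(* Main.v *)
Require Import Defs.
From HB Require Import structures.
From mathcomp Require Import all_boot all_order all_algebra all_fingroup.
From mathcomp Require Import all_classical all_reals all_analysis.
From mathcomp Require Import zify lra.

(** Let [P] be the compact set of pairs [(f x, g x)] with [x] in [X].  The
    function [h t = max ({0} `|` {1 / y ^ 2 : (y, z) in P, z ^ 2 * t >= 1})] is
    definable, so [h t < t ^ N] for large [t] with [N] effective.  Taking
    [t = 1 / z ^ 2] gives [|z| ^ N <= |y|] for small nonzero [z]; away from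
    [z = 0] a single value of [h] bounds [|y|] from below.

    Only the passage from the graphs of [f] and [g] to [P] involves the
    dimension [n], and diagonals of R^n may have arbitrarily large formats.
    They are avoided by intersecting the two cylinders over the graphs in
    R^(n + 2), at the cost of two permutations of coordinates.  The remaining
    auxiliary sets live in R^2 and R^4 and are fixed, so that any format of
    theirs is an absolute constant. *)

Set Implicit Arguments.
Unset Strict Implicit.
Unset Printing Implicit Defensive.

Import Order.TTheory GRing.Theory Num.Theory.
Import numFieldNormedType.Exports.

Local Open Scope classical_set_scope.
Local Open Scope ring_scope.

(** * Closure properties of primitive recursive functions *)

Lemma primitive_recursive_ext k (f g : k.-tuple nat -> nat) :
  f =1 g -> primitive_recursive f -> primitive_recursive g.
Proof. by move=> /funext <-. Qed.

Lemma primitive_recursive_comp1 k (e : nat -> nat) (f : k.-tuple nat -> nat) :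
  primitive_recursive1 e -> primitive_recursive f ->
  primitive_recursive (fun x => e (f x)).
Proof.
move=> he hf.
apply: primitive_recursive_ext (pr_comp he (fun _ : 'I_1 => hf)) => x /=.
by rewrite tnth_mktuple.
Qed.

Lemma primitive_recursive_comp2 k (e : nat -> nat -> nat)
    (f g : k.-tuple nat -> nat) :
  primitive_recursive2 e -> primitive_recursive f -> primitive_recursive g ->
  primitive_recursive (fun x => e (f x) (g x)).
Proof.
move=> he hf hg.
have hfg (i : 'I_2) : primitive_recursive (if i == ord0 then f else g).
  by case: ifP.
apply: primitive_recursive_ext (pr_comp he hfg) => x /=.
by rewrite !tnth_mktuple.
Qed.

Lemma primitive_recursive_const k c :
  primitive_recursive (fun _ : k.-tuple nat => c).
Proof.
elim: c => [|c IH]; last exact: (primitive_recursive_comp1 pr_succ IH).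
have h0 (i : 'I_0) : primitive_recursive (fun _ : k.-tuple nat => 0%N).
  by case: i.
exact: (pr_comp pr_zero h0).
Qed.

Lemma primitive_recursive_add : primitive_recursive2 addn.
Proof.
have h0 := pr_proj (ord0 : 'I_1).
(* In the argument [i :: r :: behead x] of the recursion step, index 1 is the value [r] reached so
   far. *)
have h1 := primitive_recursive_comp1 pr_succ (pr_proj (inord 1 : 'I_3)).
apply: primitive_recursive_ext (pr_rec h0 h1) => x.
have -> : ord_max = inord (ord0 : 'I_1).+1 :> 'I_2.
  by apply: val_inj; rewrite /= inordK.
rewrite -tnth_behead /thead; elim: (tnth x ord0) => [|i /= ->] //.
have -> : inord 1 = lift ord0 (ord0 : 'I_2).
  by apply/val_inj; rewrite /= inordK.
by rewrite tnthS tnth0 addSn.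
Qed.

Lemma primitive_recursive_sum (e : nat -> nat) :
  primitive_recursive1 e ->
  primitive_recursive1 (fun n => \sum_(i < n) e i)%N.
Proof.
move=> he.
have h := primitive_recursive_comp2 primitive_recursive_add
  (pr_proj (inord 1 : 'I_2))
  (primitive_recursive_comp1 he (pr_proj (ord0 : 'I_2))).
apply: primitive_recursive_ext (pr_rec pr_zero h) => x.
rewrite /thead; elim: (tnth x ord0) => [|i /= ->]; first by rewrite big_ord0.
have -> : inord 1 = lift ord0 (ord0 : 'I_1).
  by apply/val_inj; rewrite /= inordK.
by rewrite tnthS !tnth0 big_ord_recr.
Qed.

(** * Definable sets, without control of formats *)

Lemma omin_setI (R : realType) (S : set_collection R) :
  o_minimal_expansion S ->
  forall n A B, S n A -> S n B -> S n (A `&` B).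
Proof.
move=> hS n A B hA hB; rewrite -(setCK (A `&` B)) setCI.
by apply: (omin_setC hS); apply: (omin_setU hS); apply: (omin_setC hS).
Qed.

Lemma omin_forall (R : realType) (S : set_collection R) :
  o_minimal_expansion S ->
  forall n (I : finType) (F : I -> set 'rV[R]_n),
    (forall i, S n (F i)) -> S n [set x | forall i, F i x].
Proof.
move=> hS n I F hF.
suff h (s : seq I) : S n [set x | forall i, i \in s -> F i x].
  suff -> : [set x | forall i, F i x] =
    [set x | forall i, i \in enum I -> F i x] by exact: h.
  by apply/seteqP; split=> x /= hx i => [_|]; apply: hx; rewrite ?mem_enum.
elim: s => [|i s IH].
  suff -> : [set x | forall i : I, i \in [::] -> F i x] = setT.
    exact: omin_setT.
  by apply/seteqP; split.
suff -> : [set x | forall j, j \in i :: s -> F j x] =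
    F i `&` [set x | forall j, j \in s -> F j x] by apply: omin_setI.
apply/seteqP; split=> [x hx|x [hi hs] j].
  by split=> [|j js]; apply: hx; rewrite inE ?eqxx // js orbT.
by rewrite inE => /orP[/eqP ->|/hs].
Qed.

(** The selected coordinates are appended as m new ones, tied to the old ones by diagonals, and then
    projected away. The map [sigma] may repeat or omit coordinates, so basic relations can be placed
    on any coordinates of any space. *)
Lemma omin_reindex (R : realType) (S : set_collection R) :
  o_minimal_expansion S ->
  forall m d (sigma : 'I_m -> 'I_d) A, S m A ->
    S d [set x : 'rV_d | A (\row_i x 0 (sigma i))].
Proof.
move=> hS m d sigma A hA.
suff -> : [set x : 'rV[R]_d | A (\row_i x 0 (sigma i))] =
    projection (cartesian setT A `&`
      [set z | forall i, z 0 (rshift d i) = z 0 (lshift m (sigma i))]).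
  apply: (omin_projection hS); apply: (omin_setI hS).
    exact: (omin_cartesian hS (omin_setT hS _)).
  exact: (omin_forall hS (fun i => omin_diagonal hS _ _)).
apply/seteqP; split=> [x hx|_ [z [[_ hz] /= hi] <-]] /=.
  exists (row_mx x (\row_i x 0 (sigma i))); last by rewrite row_mxKl.
  split; first by split=> //=; rewrite row_mxKr.
  by move=> i /=; rewrite row_mxEl row_mxEr mxE.
suff -> : \row_i lsubmx z 0 (sigma i) = rsubmx z by [].
by apply/rowP => i; rewrite !mxE hi.
Qed.

Lemma omin_graph2 (R : realType) (S : set_collection R) (op : R -> R -> R) :
  o_minimal_expansion S ->
  S (2 + 1)%N (graph setT (fun x : 'rV[R]_2 => op (x 0 0) (x 0 1))) ->
  forall d (i j k : 'I_d), S d [set x | op (x 0 i) (x 0 j) = x 0 k].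
Proof.
move=> hS hop d i j k.
pose sg (a : 'I_(2 + 1)) :=
  match fintype.split a with inl a => if a == 0 then i else j | inr _ => k end.
have := omin_reindex hS sg hop.
set A := (X in S d X); set B := (X in _ -> S d X); suff -> : A = B by [].
have sgE (x : 'rV[R]_d) : \row_a x 0 (sg a) =
    row_mx (\row_a x 0 (if a == 0 then i else j)) (x 0 k)%:M.
  apply/rowP => a; rewrite !mxE /sg; case: fintype.splitP => b _ /=.
    by rewrite !mxE.
  by rewrite !mxE [b]ord1 eqxx.
apply/seteqP; split=> x; rewrite /A /B /= sgE.
  move=> [y _ /eq_row_mx [-> /(congr1 (fun M : 'M[R]_(1, 1) => M 0 0))]].
  by rewrite !mxE eqxx.
move=> h; exists (\row_a x 0 (if a == 0 then i else j)) => //.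
by rewrite !mxE /= h.
Qed.

Lemma omin_ltE (R : realType) (S : set_collection R) :
  o_minimal_expansion S ->
  forall d (i j : 'I_d), S d [set x | x 0 i < x 0 j].
Proof.
move=> hS d i j.
have := omin_reindex hS (fun a : 'I_2 => if a == 0 then i else j) (omin_lt hS).
set A := (X in S d X); set B := (X in _ -> S d X); suff -> : A = B by [].
by apply/seteqP; split=> x; rewrite /A /B /= !mxE.
Qed.

(** In coordinates (t, u, y, z) this is the relation that defines the values u competing for the
    maximum h t; the pair (y, z) will be restricted to P and projected away. *)
Lemma omin_reciprocal_squares (R : realType) (S : set_collection R) :
  o_minimal_expansion S ->
  S (2 + 2)%N [set w | w 0 (rshift 2 0) ^+ 2 * w 0 (lshift 2 1) = 1 /\
                       1 <= w 0 (rshift 2 1) ^+ 2 * w 0 (lshift 2 0)].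
Proof.
move=> hS.
pose t : 'I_(4 + 4) := lshift 4 (lshift 2 0 : 'I_(2 + 2)).
pose u : 'I_(4 + 4) := lshift 4 (lshift 2 1 : 'I_(2 + 2)).
pose y : 'I_(4 + 4) := lshift 4 (rshift 2 0 : 'I_(2 + 2)).
pose z : 'I_(4 + 4) := lshift 4 (rshift 2 1 : 'I_(2 + 2)).
(* Four auxiliary coordinates hold y^2, z^2, 1 and z^2 t, so that every condition is a single sum,
   product or comparison. *)
pose y2 : 'I_(4 + 4) := rshift 4 (@Ordinal 4 0 isT).
pose z2 : 'I_(4 + 4) := rshift 4 (@Ordinal 4 1 isT).
pose o : 'I_(4 + 4) := rshift 4 (@Ordinal 4 2 isT).
pose z2t : 'I_(4 + 4) := rshift 4 (@Ordinal 4 3 isT).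
(* The constant 1 is defined without parameters, as the idempotent [o] with [o + o] different from
   [o]. *)
pose A : set 'rV[R]_(4 + 4) :=
  [set w | w 0 y * w 0 y = w 0 y2] `&` [set w | w 0 y2 * w 0 u = w 0 o] `&`
  [set w | w 0 z * w 0 z = w 0 z2] `&` [set w | w 0 z2 * w 0 t = w 0 z2t] `&`
  [set w | w 0 o * w 0 o = w 0 o] `&` ~` [set w | w 0 o + w 0 o = w 0 o] `&`
  ~` [set w | w 0 z2t < w 0 o].
have hA : S (4 + 4)%N A.
  do ![apply: (omin_setI hS)]; try apply: (omin_setC hS);
  by [exact: (omin_graph2 hS (omin_mul hS))
     | exact: (omin_graph2 hS (omin_add hS))
     | exact: (omin_ltE hS)].
have := omin_projection hS hA.
set B := (X in S _ X); set C := (X in _ -> S _ X); suff -> : B = C by [].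
apply/seteqP; split=> [_ [w [[[[[[h1 h2] h3] h4] h5] h6] h7] <-]|].
  rewrite /C /= !mxE.
  have o1 : w 0 o = 1.
    have /eqP : w 0 o * (w 0 o - 1) = 0 by rewrite mulrBr mulr1 h5 subrr.
    rewrite mulf_eq0 subr_eq0 => /orP[/eqP o0|/eqP //].
    by case: h6; rewrite /= o0 addr0.
  rewrite !expr2; split; first by rewrite h1 h2.
  by rewrite h3 h4 -o1 leNgt; apply/negP.
move=> w; change 'rV[R]_(2 + 2) in w; move=> [h1 h2].
exists (row_mx w (\row_j nth 0 [:: w 0 (rshift 2 0) ^+ 2; w 0 (rshift 2 1) ^+ 2;
    1; w 0 (rshift 2 1) ^+ 2 * w 0 (lshift 2 0)] j)); last by rewrite row_mxKl.
rewrite /A /= !row_mxEl !row_mxEr !mxE /= -!expr2 h1 expr1n.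
do ![split=> //]; first by move/eqP; rewrite -subr_eq0 addrK oner_eq0.
by apply/negP; rewrite -leNgt.
Qed.

(** * Formats under elementary operations *)

Lemma eff_le (R : realType) (S : set_collection R)
    (Omega : nat -> set_collection R) (E : nat -> nat) :
  effectively_o_minimal S Omega E ->
  forall s t n (A : set 'rV[R]_n), (s <= t)%N -> Omega s n A -> Omega t n A.
Proof.
move=> hS s t n A /subnK <- hA.
by elim: (t - s)%N => // k /(eff_increasing hS).
Qed.

Lemma eff_ex (R : realType) (S : set_collection R)
    (Omega : nat -> set_collection R) (E : nat -> nat) :
  effectively_o_minimal S Omega E ->
  forall n (A : set 'rV[R]_n), S n A -> exists s, Omega s n A.
Proof.
by move=> hS n A; rewrite -(eff_exhaustive hS) => -[s _ hA]; exists s.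
Qed.

Lemma eff_sub (R : realType) (S : set_collection R)
    (Omega : nat -> set_collection R) (E : nat -> nat) :
  effectively_o_minimal S Omega E ->
  forall n (A : set 'rV[R]_n) s, Omega s n A -> S n A.
Proof. by move=> hS n A s hA; rewrite -(eff_exhaustive hS); exists s. Qed.

(** Exhaustion by the filtration and well-ordering of the naturals give a minimum, so [xget] does
    not fall back on its default. *)
Lemma formatP (R : realType) (S : set_collection R)
    (Omega : nat -> set_collection R) (E : nat -> nat) :
  effectively_o_minimal S Omega E ->
  forall n (A : set 'rV[R]_n), S n A ->
  Omega (format Omega A) n A /\
  forall t, Omega t n A -> (format Omega A <= t)%N.
Proof.
move=> hS n A /(eff_ex hS) hA; rewrite /format; case: xgetP => [_ _ []//|hmin].
have hA' : exists s, `[< Omega s n A >].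
  by case: hA => s h; exists s; apply/asboolP.
case: (ex_minnP hA') => m /asboolP hm mmin.
by case: (hmin m); split=> // t ht; apply: mmin; apply/asboolP.
Qed.

(** The whole space has no prescribed format; any set in the same R^n bounds it, at a cost
    independent of n. It serves as padding in products, since [eff_cartesian] only multiplies sets
    of equal dimension. *)
Lemma eff_setT (R : realType) (S : set_collection R)
    (Omega : nat -> set_collection R) (E : nat -> nat) :
  effectively_o_minimal S Omega E ->
  forall s n (A : set 'rV[R]_n), Omega s n A -> Omega s.+2 n setT.
Proof.
move=> hS s n A hA; rewrite -(setUv A).
exact: (eff_setU hS (eff_increasing hS hA) (eff_setC hS hA)).
Qed.

Lemma eff_ex_finite (R : realType) (S : set_collection R)
    (Omega : nat -> set_collection R) (E : nat -> nat) :
  effectively_o_minimal S Omega E ->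
  forall n (I : finType) (F : I -> set 'rV[R]_n),
  (forall i, S n (F i)) -> exists c, forall i, Omega c n (F i).
Proof.
move=> hS n I F hF; have /choice[c hc] : forall i, exists s, Omega s n (F i).
  by move=> i; exact: (eff_ex hS).
by exists (\max_i c i)%N => i; exact: (eff_le hS (leq_bigmax i) (hc i)).
Qed.

(** * Coordinate permutations and the set of value pairs *)

(** For fixed d there are finitely many permutations, so one constant bounds the formats of all
    their graphs in R^(d + d). Intersecting such a graph with a cylinder over A and projecting gives
    the image. *)
Lemma eff_col_perm (R : realType) (S : set_collection R)
    (Omega : nat -> set_collection R) (E : nat -> nat) :
  effectively_o_minimal S Omega E ->
  forall d, exists c, forall s (sigma : 'S_d) (A : set 'rV[R]_d),
  Omega s d A -> Omega (s + c)%N d [set col_perm sigma x | x in A].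
Proof.
move=> hS d.
have [c hc] : exists c, forall sigma : 'S_d, Omega c (d + d)%N
    [set z | forall i, z 0 (lshift d i) = z 0 (rshift d (sigma i))].
  apply: (eff_ex_finite hS) => sigma.
  have oS := eff_o_minimal hS.
  exact: (omin_forall oS (fun i => omin_diagonal oS _ _)).
exists (c + 5)%N => s sigma A hA.
have hTA := eff_cartesian hS (eff_setT hS hA)
  (eff_le hS (leqW (leqnSn s)) hA).
have hI := eff_setI hS (eff_le hS (leq_addr c _) hTA)
  (eff_le hS (leq_addl s.+3 c) (hc sigma)).
have hP := eff_projection hS hI.
suff <- : projection (k := d) (m := d) (cartesian setT A `&`
    [set z | forall i, z 0 (lshift d i) = z 0 (rshift d (sigma i))]) =
    [set col_perm sigma x | x in A] by apply: (eff_le hS) hP; lia.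
apply/seteqP; split=> [_ [z [[_ hz] /= hi] <-]|_ [x hx <-]].
  by exists (rsubmx z) => //; apply/rowP => i; rewrite !mxE hi.
exists (row_mx (col_perm sigma x) x); last by rewrite row_mxKl.
split; first by split=> //=; rewrite row_mxKr.
by move=> i /=; rewrite row_mxEl row_mxEr mxE.
Qed.

(** This form of [eff_projection] accepts a dimension d not written as a sum k + m, and so avoids
    casts between types of row vectors. *)
Lemma eff_initial_coordinates (R : realType) (S : set_collection R)
    (Omega : nat -> set_collection R) (E : nat -> nat) :
  effectively_o_minimal S Omega E ->
  forall s d k (hk : (k <= d)%N) (A : set 'rV[R]_d),
  Omega s d A ->
  Omega s.+1 k
    [set x | exists2 z, A z & forall i, x 0 i = z 0 (widen_ord hk i)].
Proof.
move=> hS s d k hk A.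
have [m dE] : exists m, d = (k + m)%N by exists (d - k)%N; rewrite subnKC.
subst d => hA; have := eff_projection hS hA.
set B := projection _; set C := (X in _ -> Omega _ _ X); suff -> : B = C by [].
have wE i : widen_ord hk i = lshift m i by apply: val_inj.
apply/seteqP; split=> [_ [z hz <-]|x [z hz hx]].
  by exists z => // i; rewrite mxE wE.
by exists z => //; apply/rowP => i; rewrite mxE hx wE.
Qed.


(** Since only equal dimensions can be multiplied, the graph is multiplied by all of R^(n + 1) and
    the first n + 2 coordinates are kept. The whole space, the product and the projection cost 2 + 1
    + 1. *)
Lemma eff_graph_cylinder (R : realType) (S : set_collection R)
    (Omega : nat -> set_collection R) (E : nat -> nat) :
  effectively_o_minimal S Omega E ->
  forall s n (X : set 'rV[R]_n) (f : 'rV[R]_n -> R)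
    (a : 'I_(2 + n)) (hn : (n <= 2 + n)%N), a = n :> nat ->
  Omega s (n + 1)%N (graph X f) ->
  Omega (s + 4)%N (2 + n)%N [set w | exists2 x, X x &
    (forall i, w 0 (widen_ord hn i) = x 0 i) /\ w 0 a = f x].
Proof.
move=> hS s n X f a hn aE hf.
have hk : (2 + n <= n + 1 + (n + 1))%N by lia.
have := eff_initial_coordinates hS hk
  (eff_cartesian hS (eff_le hS (leqW (leqnSn s)) hf) (eff_setT hS hf)).
rewrite addn4; set A := (X in Omega _ _ X); set B := (X in _ -> Omega _ _ X).
suff -> : A = B by [].
apply/seteqP; split=> [w [z [[x hx xz] _] hw]|w [x hx [wx wa]]].
  exists x => //; split=> [i|]; rewrite hw.
    have -> : widen_ord hk (widen_ord hn i) = lshift (n + 1) (lshift 1 i).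
      exact: val_inj.
    by have := congr1 (fun M : 'rV_(n + 1) => M 0 (lshift 1 i)) xz;
      rewrite row_mxEl mxE.
  have -> : widen_ord hk a = lshift (n + 1) (rshift n 0).
    by apply: val_inj; rewrite /= addn0.
  have := congr1 (fun M : 'rV_(n + 1) => M 0 (rshift n 0)) xz.
  by rewrite row_mxEr !mxE eqxx.
(* Only the first of the n + 1 padding coordinates survives the projection; it has to be the last,
   free coordinate of [w]. *)
exists (row_mx (row_mx x (f x)%:M) (const_mx (w 0 ord_max))).
  by split=> //=; rewrite row_mxKl; exists x.
move=> i; rewrite mxE; case: fintype.splitP => j /= ij; last first.
  rewrite mxE; congr (w 0 _); apply: val_inj => /=.
  by move: (ltn_ord i); rewrite /= in ij *; lia.
rewrite mxE; case: fintype.splitP => k /= jk.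
  by rewrite -wx; congr (w 0 _); apply: val_inj; rewrite /= ij jk.
rewrite mxE [k]ord1 eqxx -wa; congr (w 0 _); apply: val_inj.
by rewrite /= ij jk aE [k]ord1 addn0.
Qed.

(** One permutation moves the value of g to the last coordinate, so the two cylinders meet in the
    points (x, f x, g x). A second one brings both values to the front, where a projection reads
    them off. *)
Lemma eff_value_pairs (R : realType) (S : set_collection R)
    (Omega : nat -> set_collection R) (E : nat -> nat) :
  effectively_o_minimal S Omega E ->
  forall n (p : nat -> nat),
  (forall s (sigma : 'S_(2 + n)) (A : set 'rV[R]_(2 + n)),
    Omega s (2 + n)%N A ->
    Omega (p s) (2 + n)%N [set col_perm sigma x | x in A]) ->
  forall s (X : set 'rV[R]_n) (f g : 'rV[R]_n -> R),
  Omega s (n + 1)%N (graph X f) -> Omega s (n + 1)%N (graph X g) ->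
  Omega (p (s + 5 + p (s + 4))%N).+1 2
    [set v | exists2 x, X x & f x = v 0 0 /\ g x = v 0 1].
Proof.
move=> hS n p hp s X f g hf hg.
have hn : (n <= 2 + n)%N by lia.
have hn1 : (n < 2 + n)%N by lia.
pose a : 'I_(2 + n) := Ordinal hn1.
pose b : 'I_(2 + n) := ord_max.
have ab : b != a by rewrite -val_eqE /=; lia.
have hF := eff_graph_cylinder hS (a := a) hn erefl hf.
have hG := hp _ (tperm a b) _ (eff_graph_cylinder hS (a := a) hn erefl hg).
have l1 : (s + 4 <= s + 4 + p (s + 4))%N by lia.
have l2 : (p (s + 4) <= s + 4 + p (s + 4))%N by lia.
have := eff_setI hS (eff_le hS l1 hF) (eff_le hS l2 hG).
have -> : (s + 4 + p (s + 4)).+1%N = (s + 5 + p (s + 4))%N by lia.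
set T := _ `&` _ => hT.
pose i0 : 'I_(2 + n) := lshift n 0.
pose i1 : 'I_(2 + n) := lshift n 1.
(* The left factor acts first. The order matters: for n = 1 the coordinates [i1] and [a]
   coincide. *)
pose sg : 'S_(2 + n) := (tperm i1 b * tperm i0 a)%g.
have b0 : b != i0 by rewrite -val_eqE.
have i10 : i1 != i0 by rewrite -val_eqE.
have sg0 : sg (lshift n 0) = a by rewrite permM [tperm _ b _]tpermD ?tpermL.
have sg1 : sg (lshift n 1) = b by rewrite permM tpermL tpermD // eq_sym.
have := eff_projection hS (hp _ sg _ hT).
set A := (X in Omega _ _ X); set B := (X in _ -> Omega _ _ X).
suff -> : A = B by [].
(* The swap fixes the first n coordinates, so both cylinders determine the same point x. *)
have tw i : tperm a b (widen_ord hn i) = widen_ord hn i.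
  have hi := ltn_ord i.
  by rewrite tpermD // -val_eqE /= neq_ltn ?hi ?(ltn_trans hi (ltnSn n)) orbT.
apply/seteqP; split=>
  [_ [_ [w [[x hx [wx wa]] [w' [x' hx' [wx' wa']] ww]] <-] <-]|].
  have xx : x' = x.
    by apply/rowP => i; rewrite -wx -wx' -ww mxE tw.
  exists x => //; rewrite !mxE sg0 sg1 wa; split=> //.
  by rewrite -ww mxE tpermR wa' xx.
move=> v [x hx [fv gv]].
have e : (2 + n)%N = (n + 1 + 1)%N by lia.
pose W := \row_i row_mx (row_mx x (f x)%:M) (g x)%:M 0 (cast_ord e i).
have Wx i : W 0 (widen_ord hn i) = x 0 i.
  rewrite mxE (_ : cast_ord _ _ = lshift 1 (lshift 1 i)); last exact: val_inj.
  by rewrite !row_mxEl.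
have Wa : W 0 a = f x.
  rewrite mxE (_ : cast_ord _ _ = lshift 1 (rshift n 0)).
    by rewrite row_mxEl row_mxEr mxE.
  by apply: val_inj; rewrite /= addn0.
have Wb : W 0 b = g x.
  rewrite mxE (_ : cast_ord _ _ = rshift (n + 1) 0).
    by rewrite row_mxEr mxE.
  by apply: val_inj; rewrite /= addn0 addn1.
exists (col_perm sg W).
  exists W => //; split; first by exists x.
  exists (col_perm (tperm a b) W).
    exists x => //; split=> [i|]; first by rewrite mxE tw Wx.
    by rewrite mxE tpermL Wb.
  by apply/rowP => i; rewrite !mxE tpermK.
apply/rowP; case=> [[|[|//]] hi]; rewrite 2!mxE.
  by rewrite (_ : Ordinal hi = 0) ?sg0 ?Wa ?fv //; apply: val_inj.
by rewrite (_ : Ordinal hi = 1) ?sg1 ?Wb ?gv //; apply: val_inj.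
Qed.

(** * The function h: its format and its existence *)

(** The graph of h consists of the pairs (t, u) in [Q] with no larger u' such that (t, u') is in
    [Q], where [Q] is the relation [B t u]. All other sets involved are fixed, hence the constant c
    is independent of [D] and [h]. *)
Lemma eff_reciprocal_max (R : realType) (S : set_collection R)
    (Omega : nat -> set_collection R) (E : nat -> nat) :
  effectively_o_minimal S Omega E ->
  exists c, forall s (D : R -> R -> Prop) (h : R -> R),
  let B t u := u = 0 \/
    exists y z, [/\ D y z, y ^+ 2 * u = 1 & 1 <= z ^+ 2 * t] in
  (forall t, B t (h t) /\ forall u, B t u -> u <= h t) ->
  Omega s 2 [set v | D (v 0 0) (v 0 1)] ->
  Omega (s + c)%N (1 + 1)%N (graph1 h).
Proof.
move=> hS; have oS := eff_o_minimal hS.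
have [cM hM] := eff_ex hS (omin_reciprocal_squares oS).
pose L : set 'rV[R]_(2 + 2) := [set w | w 0 (lshift 2 0) = w 0 (rshift 2 0)] `&`
  [set w | w 0 (lshift 2 1) < w 0 (rshift 2 1)].
have [cL hL] : exists cL, Omega cL (2 + 2)%N L.
  apply: (eff_ex hS); apply: (omin_setI oS); first exact: (omin_diagonal oS).
  exact: (omin_ltE oS).
(* The line u = 0 is defined by u + u = u. *)
have [cZ hZ] := eff_ex hS (omin_graph2 oS (omin_add oS) (1 : 'I_2) 1 1).
(* Six operations lead to [Q] and seven more to the set of its fibrewise maxima. *)
exists (cM + cL + cZ + 13)%N => s D h B hB.
set P := [set v | D _ _] => hP.
have hTP := eff_cartesian hS (eff_setT hS hP) (eff_le hS (leqW (leqnSn s)) hP).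
have lM : (s.+3 <= s + 3 + cM + cZ)%N by lia.
have lM' : (cM <= s + 3 + cM + cZ)%N by lia.
have hI := eff_projection hS
  (eff_setI hS (eff_le hS lM hTP) (eff_le hS lM' hM)).
have lZ : (cZ <= (s + 3 + cM + cZ).+2)%N by lia.
have := eff_setU hS (eff_le hS lZ hZ) hI.
set q := (X in Omega X); set Q := (X in Omega _ _ X) => hQ.
have QE v : Q v <-> B (v 0 0) (v 0 1).
  split=> [[/= v1|[w [[_ /= hD] [w1 w2]] <-]]|[v1|[y [z [hD h1 h2]]]]].
  - by left; move/eqP: v1; rewrite -subr_eq0 addrK => /eqP.
  - right; exists (w 0 (rshift 2 0)), (w 0 (rshift 2 1)).
    by move: hD; rewrite /P /= !mxE.
  - by left; rewrite /= v1 addr0.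
  right; exists (row_mx v (\row_i if i == 0 then y else z));
    last by rewrite row_mxKl.
  split; first by split=> //=; rewrite /P /= row_mxKr !mxE.
  by rewrite /= !row_mxEl !row_mxEr !mxE.
have hTQ := eff_cartesian hS (eff_setT hS hQ) (eff_le hS (leqW (leqnSn q)) hQ).
have lL : (q.+3 <= q + 3 + cL)%N by lia.
have lL' : (cL <= q + 3 + cL)%N by lia.
(* The projection collects the points (t, u) lying strictly below some point of [Q] on the same
   vertical line. *)
have hC := eff_setC hS
  (eff_projection hS (eff_setI hS (eff_le hS lL hTQ) (eff_le hS lL' hL))).
have lQ : (q <= (q + 3 + cL).+3)%N by lia.
have := eff_setI hS (eff_le hS lQ hQ) hC.
have -> : (q + 3 + cL).+4%N = (s + (cM + cL + cZ + 13))%N by rewrite /q; lia.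
set A := (X in Omega _ _ X).
suff -> : A = graph1 h by [].
have gE (v : 'rV_2) : v = row_mx (const_mx (v 0 0)) (v 0 1)%:M :> 'rV_(1 + 1).
  apply/rowP; case=> [[|[|//]] hi].
    rewrite (_ : Ordinal hi = lshift 1 0 :> 'I_(1 + 1)); last exact: val_inj.
    by rewrite row_mxEl mxE; congr (v 0 _); exact: val_inj.
  rewrite (_ : Ordinal hi = rshift 1 0 :> 'I_(1 + 1)); last exact: val_inj.
  by rewrite row_mxEr mxE; congr (v 0 _); exact: val_inj.
apply/seteqP; split=> [v [/QE vQ hmax]|_ [x _ <-]].
  have [h1 h2] := hB (v 0 0).
  have vh : v 0 1 = h (v 0 0).
    apply/eqP; rewrite eq_le h2 //= leNgt; apply/negP => vlt; apply: hmax.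
    exists (row_mx v (\row_i if i == 0 then v 0 0 else h (v 0 0))).
      split; first by split=> //=; rewrite row_mxKr; apply/QE; rewrite !mxE.
      by split; rewrite /= row_mxEl row_mxEr mxE.
    by rewrite row_mxKl.
  by exists (const_mx (v 0 0)) => //; rewrite mxE -vh -gE.
set v := row_mx _ _.
have v0 : v 0 0 = x 0 0.
  rewrite (_ : 0 = lshift 1 0 :> 'I_(1 + 1)) ?row_mxEl //; exact: val_inj.
have v1 : v 0 1 = h (x 0 0).
  rewrite (_ : 1 = rshift 1 0 :> 'I_(1 + 1)) ?row_mxEr ?mxE //; exact: val_inj.
have [h1 h2] := hB (x 0 0).
split; first by apply/QE; rewrite v0 v1.
move=> [w [[_ /QE wQ] [/= w1 w2]] wv].
move: wQ; rewrite !mxE -w1 => wQ.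
move: w1 w2 (congr1 (fun M : 'rV_2 => M 0 0) wv)
  (congr1 (fun M : 'rV_2 => M 0 1) wv).
rewrite v0 v1 !mxE => _ w2 w00 w01; move: wQ w2; rewrite w00 w01 => /h2.
by rewrite leNgt => /negP.
Qed.

(** The admissible pairs (y, z) form a compact set [K]. On it y is nonzero, since y = 0 would force
    z = 0, against 1 <= z^2 t. Hence y^2 has a positive minimum, whose inverse is the maximum; when
    [K] is empty, the adjoined value 0 is the maximum. *)
Lemma reciprocal_max_ex (R : realType) (T : topologicalType) (X : set T)
    (f g : T -> R) :
  compact X -> {within X, continuous f} -> {within X, continuous g} ->
  (forall x, X x -> f x = 0 -> g x = 0) ->
  forall t, exists m,
  let B u := u = 0 \/ exists y z, [/\ exists2 x, X x & f x = y /\ g x = z,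
    y ^+ 2 * u = 1 & 1 <= z ^+ 2 * t] in
  B m /\ forall u, B u -> u <= m.
Proof.
move=> cX cf cg fg t.
pose K := [set (f x, g x) | x in X] `&` [set p | 1 <= p.2 ^+ 2 * t].
have cK : compact K.
  apply: compact_closedI.
    apply: continuous_compact => // x; exact: (cvg_pair (cf x) (cg x)).
  apply: (@preimage_closed _ _ (fun p : R * R => p.2 ^+ 2 * t)
    [set r | 1 <= r]).
    move=> p _; have p2 : q.2 @[q --> p] --> p.2 by exact: cvg_snd.
    exact: (cvgM (cvgM p2 p2) (cvg_cst t)).
  exact: closed_ge.
have [/set0P K0|/negPn/eqP K0] := boolP (K != set0).
  have [|[y z] /set_mem[[x Xx [fx gx]] /= zt] ymin] :=
    @compact_EVT_min _ R (fun p : R * R => p.1 ^+ 2) K K0 cK.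
    apply: continuous_subspaceT => p.
    have p1 : q.1 @[q --> p] --> p.1 by exact: cvg_fst.
    exact: (cvgM p1 p1).
  have y0 : 0 < y ^+ 2.
    rewrite lt_neqAle sqr_ge0 andbT eq_sym sqrf_eq0.
    apply/eqP => y0; move: zt; rewrite -gx fg ?fx // expr0n mul0r.
    by rewrite leNgt ltr01.
  exists (y ^+ 2)^-1; split.
    right; exists y, z; split=> //; first by exists x.
    by rewrite mulfV // gt_eqF.
  move=> u [->|[y' [z' [[x' Xx' [fx' gx']] yu zt']]]].
    by rewrite invr_ge0 ltW.
  have /ymin /= yy : (y', z') \in K.
    by apply/mem_set; split=> //; exists x' => //; rewrite fx' gx'.
  have y'0 : 0 < y' ^+ 2 by apply: lt_le_trans yy.
  have -> : u = (y' ^+ 2)^-1.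
    by apply: (mulfI (lt0r_neq0 y'0)); rewrite yu mulfV // gt_eqF.
  by rewrite lef_pV2.
exists 0; split; first by left.
move=> u [->//|[y [z [[x Xx [fx gx]] yu zt]]]].
suff : K (y, z) by rewrite K0.
by split=> //; exists x => //; rewrite fx gx.
Qed.

(** * From the growth of h to the inequality *)

Lemma lojasiewicz_of_eventual_bound (R : realType) (T : topologicalType)
    (X : set T) (f g : T -> R) (h : R -> R) (N : nat) :
  compact X -> {within X, continuous g} ->
  (forall x, X x -> f x = 0 -> g x = 0) ->
  (forall t x, X x -> f x != 0 -> 1 <= g x ^+ 2 * t -> (f x ^+ 2)^-1 <= h t) ->
  (\forall t \near +oo, h t < t ^+ N) ->
  exists2 C, 0 < C & forall x, X x -> `|g x| ^+ N.+1 <= C * `|f x|.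
Proof.
move=> cX cg fg hB [M [_ hM]].
have [G [_ /(_ (Num.max G 0 + 1)) hG]] :=
  compact_bounded (continuous_compact cg cX).
pose T0 := Num.max M 1 + 1; pose G0 := Num.max G 0 + 1.
have T1 : 1 <= T0 by rewrite ler_wpDl // le_max ler01 orbT.
have MT : M < T0 by rewrite ltr_pwDr // le_max lexx.
have G00 : 0 <= G0 by rewrite addr_ge0 // le_max lexx orbT.
have {}hG x : X x -> `|g x| <= G0.
  by move=> Xx; apply: hG; [rewrite ltr_pwDr // le_max lexx|exists x].
(* The first summand serves the points with g^2 T0 >= 1, the second those with 0 < g^2 T0 < 1. *)
exists (G0 ^+ N.+1 * T0 ^+ N + 1).
  by rewrite ltr_wpDl // mulr_ge0 ?exprn_ge0 //; lra.
move=> x Xx.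
have D0 : 0 <= G0 ^+ N.+1 * T0 ^+ N by rewrite mulr_ge0 ?exprn_ge0 //; lra.
have [g0|g0] := eqVneq (g x) 0.
  by rewrite g0 normr0 expr0n /= mulr_ge0 // addr_ge0.
have f0 : f x != 0 by apply: contra_neq g0; exact: fg.
have f2 : 0 < `|f x| by rewrite normr_gt0.
have f2' : 0 < f x ^+ 2 by rewrite -real_normK ?num_real // exprn_gt0.
have g2 : 0 < `|g x| by rewrite normr_gt0.
have g2' : 0 < g x ^+ 2 by rewrite -real_normK ?num_real // exprn_gt0.
have [large|small] := leP 1 (g x ^+ 2 * T0).
  have lt1 := le_lt_trans (hB _ _ Xx f0 large) (hM _ MT).
  have le1 : 1 <= T0 ^+ N * `|f x|.
    (* The bound 1 / f^2 < T0^N controls f^2 rather than |f|; after squaring, T0 >= 1 absorbs the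
       extra factor T0^N. *)
    rewrite -(@expr_ge1 _ 2) ?mulr_ge0 ?exprn_ge0 //; last by lra.
    rewrite exprMn real_normK ?num_real //.
    apply: (@le_trans _ _ (T0 ^+ N * f x ^+ 2)).
      by rewrite -ler_pdivrMr // mul1r ltW.
    apply: ler_wpM2r; first exact: ltW.
    by rewrite [leRHS]expr2 ler_peMl ?exprn_ege1 // exprn_ge0 //; lra.
  rewrite mulrDl mul1r ler_wpDr ?normr_ge0 // -mulrA.
  apply: (@le_trans _ _ (G0 ^+ N.+1 * 1)).
    by rewrite mulr1 lerXn2r ?nnegrE ?hG.
  by rewrite ler_wpM2l // exprn_ge0.
(* Here t = 1 / g^2 is beyond the threshold, and h t < t^N becomes |g|^N < |f|; the additional
   factor |g| is at most 1. *)
have MV : M < (g x ^+ 2)^-1.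
  by apply: lt_trans MT _; rewrite -[X in _ < X]mul1r ltr_pdivlMr // mulrC.
have le1 : 1 <= g x ^+ 2 * (g x ^+ 2)^-1 by rewrite mulfV // gt_eqF.
have := le_lt_trans (hB _ _ Xx f0 le1) (hM _ MV).
have gN : 0 < (g x ^+ 2) ^+ N by rewrite exprn_gt0.
rewrite exprVn ltf_pV2 ?posrE ?f2' ?gN // => gf.
have {}gf : `|g x| ^+ N <= `|f x|.
  rewrite -(@ler_pXn2r _ 2) ?nnegrE ?exprn_ge0 // real_normK ?num_real //.
  by rewrite -exprM mulnC exprM real_normK ?num_real // ltW.
have g1 : `|g x| <= 1.
  rewrite -(@expr_le1 _ 2) // real_normK ?num_real //.
  apply: le_trans (ltW small).
  by rewrite ler_peMr // ltW.
rewrite exprS; apply: (@le_trans _ _ (1 * `|f x|)).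
  by apply: ler_pM => //; rewrite exprn_ge0.
by rewrite ler_wpM2r // lerDr.
Qed.

(** * Effective bounds on the exponent *)

(** Common source of the fixed-dimension and the uniform statement: [b] is chosen before n and [p],
    so the dimension influences the bound only through the cost [p] of permutations. *)
Lemma lojasiewicz_of_permutations (R : realType) (S : set_collection R)
    (Omega : nat -> set_collection R) (E : nat -> nat) :
  effectively_o_minimal S Omega E ->
  effectively_polynomially_bounded S Omega ->
  exists2 b : nat -> nat, primitive_recursive1 b &
  forall n (p : nat -> nat),
  (forall s (sigma : 'S_(2 + n)) (A : set 'rV[R]_(2 + n)),
    Omega s (2 + n)%N A ->
    Omega (p s) (2 + n)%N [set col_perm sigma x | x in A]) ->
  forall (X : set 'rV[R]_n) (f g : 'rV[R]_n -> R),
  let s := (format Omega (graph X f) + format Omega (graph X g))%N in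
  closed X -> bounded_set X ->
  S (n + 1)%N (graph X f) -> S (n + 1)%N (graph X g) ->
  {within X, continuous f} -> {within X, continuous g} ->
  (forall x, X x -> f x = 0 -> g x = 0) ->
  exists (N : nat) (C : R),
    [/\ (N <= b (p (s + 5 + p (s + 4))))%N, 0 < C &
        forall x, X x -> `|g x| ^+ N <= C * `|f x|].
Proof.
move=> hS [e he hpol]; have [c hc] := eff_reciprocal_max hS.
(* The bound [e] on exponents need not be monotone, so it is replaced by its
   partial sums; the successor makes the exponent positive, for the zeros
   of g. *)
exists (fun r => (\sum_(i < r + (c + 2)) e i).+1)%N.
  apply: (primitive_recursive_comp1 pr_succ).
  apply: (primitive_recursive_comp1 (primitive_recursive_sum he)).
  apply: (primitive_recursive_comp2 primitive_recursive_add (pr_proj ord0)).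
  exact: primitive_recursive_const.
move=> n p hp X f g s clX bX hf hg cf cg fg.
have cX : compact X by exact: bounded_closed_compact.
have [/(eff_le hS (leq_addr (format Omega (graph X g)) _)) + _] :=
  formatP hS hf.
have [/(eff_le hS (leq_addl (format Omega (graph X f)) _)) + _] :=
  formatP hS hg.
rewrite -/s => hg' hf'; clearbody s.
have hP := eff_value_pairs hS hp hf' hg'.
have /choice[h hmax] := reciprocal_max_ex cX cf cg fg.
have hh := hc _ (fun y z => exists2 x, X x & f x = y /\ g x = z) h hmax hP.
have [N hN hlt] := hpol h (eff_sub hS hh).
have [_ /(_ _ hh) hfmt] := formatP hS (eff_sub hS hh).
have [||C C0 hC] := @lojasiewicz_of_eventual_bound _ _ X f g h N cX cg fg.
- move=> t x Xx fx gx; have [_] := hmax t; apply; right.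
  exists (f x), (g x); split=> //; first by exists x.
  by rewrite mulfV // expf_neq0.
- exact: hlt.
exists N.+1, C; split=> //; rewrite ltnS; apply: leq_trans hN _.
set q := format _ _ in hfmt *.
(* The graph of [h] has format at most p (...) + 1 + c, and the strict inequality needed to find
   [e q] among the summands accounts for the second unit. *)
have hq : (q < p (s + 5 + p (s + 4)) + (c + 2))%N by lia.
by rewrite (bigD1 (Ordinal hq)) //= leq_addr.
Qed.

Theorem theorem13 (R : realType) (S : set_collection R)
    (Omega : nat -> set_collection R) (E : nat -> nat)
    (hS : effectively_o_minimal S Omega E)
    (hpol : effectively_polynomially_bounded S Omega) :
  let lojasiewicz (n : nat) (e : nat -> nat -> nat) :=
    forall (X : set 'rV[R]_n) (f g : 'rV[R]_n -> R),
      closed X -> bounded_set X ->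
      S (n + 1)%N (graph X f) -> S (n + 1)%N (graph X g) ->
      {within X, continuous f} -> {within X, continuous g} ->
      (forall x, X x -> f x = 0 -> g x = 0) ->
      exists (N : nat) (C : R),
        [/\ (N <= e (format Omega (graph X f)) (format Omega (graph X g)))%N,
            0 < C &
            forall x, X x -> `|g x| ^+ N <= C * `|f x|] in
  (forall n, exists2 e, primitive_recursive2 e & lojasiewicz n e) /\
  (effective_permutations Omega ->
    exists2 e, primitive_recursive2 e & forall n, lojasiewicz n e).
Proof.
move=> lojasiewicz.
have [b hb hloj] := lojasiewicz_of_permutations hS hpol.
pose e p i j := b (p (i + j + 5 + p (i + j + 4)))%N.
have he p : primitive_recursive1 p -> primitive_recursive2 (e p).
  move=> hp; rewrite /primitive_recursive2 /e.
  have hc := primitive_recursive_const.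
  have hadd := @primitive_recursive_comp2 _ _ _ _ primitive_recursive_add.
  have hij := hadd 2 _ _ (pr_proj ord0) (pr_proj ord_max).
  apply: (primitive_recursive_comp1 hb); apply: (primitive_recursive_comp1 hp).
  apply: (hadd _ _ _ (hadd _ _ _ hij (hc _ 5%N))).
  apply: (primitive_recursive_comp1 hp); exact: hadd.
split=> [n|[p hp hperm]].
  (* In fixed dimension permutations cost an additive constant, which makes [addn^~ c] an admissible
     [p]. *)
  have [c hc] := eff_col_perm hS (2 + n).
  exists (e (addn^~ c)).
    apply: he; apply: (primitive_recursive_comp2 primitive_recursive_add).
      exact: pr_proj.
    exact: primitive_recursive_const.
  move=> X f g clX bX hf hg cf cg fg.
  by apply: (hloj n (addn^~ c)) => // s sigma A; exact: hc.
exists (e p); first exact: he.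
move=> n X f g clX bX hf hg cf cg fg.
by apply: (hloj n p) => // s sigma A; exact: hperm.
Qed.
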